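(* Let $w_1>w_2>\dots>w_n>0$ be a super-increasing sequence of weights (in decreasing order). Let $i\in N=\{1,\dots,n\}$, let $q\in(0,w(N)]$, and write $A(q)=\{a_0,\dots,a_r\}$ with $a_0<\dots<a_r$. Let $\varphi_i(q)$ be the Shapley value of agent $i$ in the weighted voting game with weights $w_1,\dots,w_n$ and quota $q$. If $i\notin A(q)$ then $$\varphi_i(q)=\sum_{\substack{t\in\{0,\dots,r\}:\\ a_t>i}}\frac{1}{a_t\binom{a_t-1}{t}}.$$ If $i\in A(q)$, say $i=a_s$, then $$\varphi_i(q)=\frac{1}{a_s\binom{a_s-1}{s}}-\sum_{\substack{t\in\{0,\dots,r\}:\\ a_t>i}}\frac{1}{a_t\binom{a_t-1}{t-1}}.$$
   Context: Super-increasing (decreasing order): $w_i>\sum_{j=i+1}^n w_j$ for all $i\in N$. For $S\subseteq N$, $w(S)=\sum_{i\in S}w_i$ and $\beta(S)=\sum_{i\in S}2^{n-i}$. For non-empty $P\subseteq N$, $P^-\subseteq N$ is the unique subset with $\beta(P^-)=\beta(P)-1$. The intervals $(w(P^-),w(P)]$, over non-empty $P\subseteq N$, partition $(0,w(N)]$; $A(q)$ denotes the unique non-empty $P$ with $q\in(w(P^-),w(P)]$. Shapley value for quota $q$: with $v(S)=1$ if $w(S)\ge q$ and $v(S)=0$ otherwise, $\varphi_i(q)=\frac1{n!}\sum_{\sigma}(v(P_i(\sigma)\cup\{i\})-v(P_i(\sigma)))$, the sum over all permutations $\sigma$ of $N$, where $P_i(\sigma)=\{j:\sigma(j)<\sigma(i)\}$.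 *)

(* Defs.v *)
From mathcomp Require Import all_boot all_order all_algebra all_fingroup.

Set Implicit Arguments.
Unset Strict Implicit.
Unset Printing Implicit Defensive.

Import Order.TTheory GRing.Theory Num.Theory.
Local Open Scope ring_scope.

(* The set of agents N = {1, ..., n} is represented by 'I_n; the agent with
   mathematical label k is the ordinal of value k - 1, so that the label of
   i : 'I_n is i.+1. *)

Section SuperIncreasing.

Variables (R : realDomainType) (n : nat).
Implicit Types (w : 'I_n -> R) (P S T : {set 'I_n}) (q : R).

Definition super_increasing w : Prop :=
  forall i : 'I_n, \sum_(j < n | (i < j)%N) w j < w i.

Definition weight w S : R := \sum_(i in S) w i.

End SuperIncreasing.

Definition beta (n : nat) (S : {set 'I_n}) : nat :=
  (\sum_(i in S) 2 ^ (n - i.+1))%N.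

(* The set P^-. It is characterized by beta_pred_set and beta_inj below when
   P is non-empty; the value at set0 is irrelevant. *)
Definition pred_set (n : nat) (P : {set 'I_n}) : {set 'I_n} :=
  odflt set0 [pick S | beta S == (beta P).-1].

Definition in_interval (R : realDomainType) (n : nat) (w : 'I_n -> R) (q : R)
    (P : {set 'I_n}) : bool :=
  (P != set0) && (weight w (pred_set P) < q <= weight w P).

(* The set A(q). The default value is not used for q in (0, w(N)]: see
   quota_setP and quota_set_unique below. *)
Definition quota_set (R : realDomainType) (n : nat) (w : 'I_n -> R) (q : R) :
    {set 'I_n} :=
  odflt set0 [pick P | in_interval w q P].

Definition wvg (R : realDomainType) (n : nat) (w : 'I_n -> R) (q : R)
    (S : {set 'I_n}) : R :=
  if q <= weight w S then 1 else 0.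

Definition predecessors (n : nat) (i : 'I_n) (s : 'S_n) : {set 'I_n} :=
  [set j | (s j < s i)%N].

Definition shapley (R : realFieldType) (n : nat) (v : {set 'I_n} -> R)
    (i : 'I_n) : R :=
  (n`!)%:R^-1 *
  \sum_(s : 'S_n) (v (predecessors i s :|: [set i]) - v (predecessors i s)).

Section WellDefined.

Variable n : nat.
Implicit Types (P S T : {set 'I_n}).

Lemma weight_lt_lex (R : realDomainType) (w : 'I_n -> R) S T (i : 'I_n) :
  super_increasing w -> i \in T -> i \notin S ->
  (forall j : 'I_n, (j < i)%N -> (j \in S) = (j \in T)) ->
  weight w S < weight w T.
Proof.
move=> sw iT iS eqST.
have w0 j : 0 <= w j.
  have [m] := ubnP (n - j)%N; elim: m j => // m IH j lt_m.
  apply/ltW/(le_lt_trans _ (sw j))/sumr_ge0 => k ltjk; apply: IH.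
  by apply: leq_trans (_ : n - j <= m)%N; rewrite ?ltn_sub2l // -ltnS.
rewrite /weight [ltLHS]big_mkcond [ltRHS]big_mkcond /=.
rewrite (bigID (fun j : 'I_n => (j < i)%N)) /=.
rewrite [ltRHS](bigID (fun j : 'I_n => (j < i)%N)) /=.
rewrite (eq_bigr (fun j => if j \in T then w j else 0)); last first.
  by move=> j /eqST ->.
rewrite ltrD2l (bigD1 i) ?ltnn //= (negPf iS) add0r.
rewrite [ltRHS](bigD1 i) ?ltnn //= iT.
apply: (@lt_le_trans _ _ (w i)); last first.
  by rewrite lerDl sumr_ge0 // => j _; case: ifP.
apply: le_lt_trans (sw i).
rewrite (eq_bigl (fun j : 'I_n => (i < j)%N)); last first.
  by move=> j; rewrite -leqNgt ltn_neqAle andbC eq_sym.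
by apply: ler_sum => j _; case: ifP.
Qed.

Lemma lex_cmp S T : S != T ->
  exists2 i : 'I_n, (i \in T) != (i \in S) &
    forall j : 'I_n, (j < i)%N -> (j \in S) = (j \in T).
Proof.
move=> neST; have /existsP[i0 Di0] : [exists i, (i \in T) != (i \in S)].
  apply: contraNT neST => /existsPn eqST; apply/eqP/setP => i.
  by have := eqST i; rewrite negbK => /eqP.
case: (@arg_minnP _ i0 (fun i => (i \in T) != (i \in S)) val Di0) => i Di mini.
exists i => // j ltji; apply/eqP; rewrite eq_sym.
by apply: contraLR ltji => /mini; rewrite -leqNgt.
Qed.

Lemma sum_expn2_lt m : (\sum_(j < n | n - m <= j) 2 ^ (n - j.+1) < 2 ^ m)%N.
Proof.
elim: m => [|m IH].
  by rewrite big1 // => j; rewrite subn0 leqNgt ltn_ord.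
have [lenm|ltmn] := leqP n m.
  apply: leq_trans (leq_trans IH _); last by rewrite leq_exp2l.
  rewrite ltnS; apply/eq_leq/eq_bigl => j.
  have /eqP -> : (n - m == 0)%N by rewrite subn_eq0.
  by have /eqP -> : (n - m.+1 == 0)%N by rewrite subn_eq0 ltnW.
have ltk : (n - m.+1 < n)%N by rewrite ltn_subrL /= (leq_trans _ ltmn).
rewrite (bigD1 (Ordinal ltk)) //= expnS mul2n -addnn -subSn // subSS.
rewrite subKn ?(ltnW ltmn) // -addnS leq_add2l.
apply: leq_trans IH; rewrite ltnS; apply/eq_leq/eq_bigl => j.
by rewrite -val_eqE /= eq_sym andbC -ltn_neqAle -subSn // subSS.
Qed.

Lemma super_increasing_expn2 :
  super_increasing (fun i : 'I_n => (2 ^ (n - i.+1))%:R : int).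
Proof.
move=> i; rewrite -natr_sum ltr_nat; apply: leq_trans (sum_expn2_lt _).
by rewrite ltnS; apply/eq_leq/eq_bigl => j; rewrite subKn.
Qed.

Lemma betaE S : ((beta S)%:R = weight (fun i => (2 ^ (n - i.+1))%:R) S :> int).
Proof. by rewrite /beta natr_sum. Qed.

Lemma beta_lt_lex S T (i : 'I_n) : i \in T -> i \notin S ->
  (forall j : 'I_n, (j < i)%N -> (j \in S) = (j \in T)) ->
  (beta S < beta T)%N.
Proof.
move=> iT iS eqST; rewrite -(ltr_nat int) !betaE.
exact: weight_lt_lex super_increasing_expn2 iT iS eqST.
Qed.

Lemma beta_inj : injective (@beta n).
Proof.
move=> S T eqb; apply/eqP; apply/negPn/negP => /lex_cmp[i Di eqST].
have [iT|iT] := boolP (i \in T); have [iS|iS] := boolP (i \in S).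
- by rewrite iT iS in Di.
- by have := beta_lt_lex iT iS eqST; rewrite eqb ltnn.
- have := beta_lt_lex iS iT (fun j h => esym (eqST j h)).
  by rewrite eqb ltnn.
- by rewrite (negPf iT) (negPf iS) in Di.
Qed.

Lemma weight_beta (R : realDomainType) (w : 'I_n -> R) S T :
  super_increasing w -> (beta S < beta T)%N -> weight w S < weight w T.
Proof.
move=> sw ltb.
have /lex_cmp[i Di eqST] : S != T.
  by apply: contraTneq ltb => ->; rewrite ltnn.
have [iT|iT] := boolP (i \in T); have [iS|iS] := boolP (i \in S).
- by rewrite iT iS in Di.
- exact: weight_lt_lex sw iT iS eqST.
- have := beta_lt_lex iS iT (fun j h => esym (eqST j h)).
  by rewrite ltnNge (ltnW ltb).
- by rewrite (negPf iT) (negPf iS) in Di.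
Qed.

Lemma beta_bound S : (beta S < 2 ^ n)%N.
Proof.
apply: leq_trans (sum_expn2_lt n); rewrite ltnS subnn /beta big_mkcond /=.
by apply: leq_sum => i _; case: ifP.
Qed.

Lemma beta_pred_set P : beta (pred_set P) = (beta P).-1.
Proof.
have injb : injective (fun S => Ordinal (beta_bound S)).
  by move=> S T [] /beta_inj.
have cardE : #|{set 'I_n}| = #|'I_(2 ^ n)|.
  by rewrite -!cardsT -powersetT card_powerset !cardsT !card_ord.
have ltb : ((beta P).-1 < 2 ^ n)%N by apply: leq_ltn_trans (beta_bound P); apply: leq_pred.
have [g _ gK] := inj_card_bij injb (eq_leq (esym cardE)).
rewrite /pred_set; case: pickP => [S /eqP //|/(_ (g (Ordinal ltb)))].
by have /(congr1 val) /= -> := gK (Ordinal ltb); rewrite eqxx.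
Qed.

Lemma quota_setP (R : realDomainType) (w : 'I_n -> R) (q : R) :
  super_increasing w -> 0 < q <= weight w [set: 'I_n] ->
  in_interval w q (quota_set w q).
Proof.
move=> sw /andP[q_gt0 q_le]; rewrite /quota_set; case: pickP => //= noP.
case: (@arg_minnP _ setT (fun P => q <= weight w P) (@beta n) q_le) => P qP minP.
have P0 : P != set0.
  by apply: contraTneq qP => ->; rewrite /weight big_set0 -ltNge.
have := noP P; rewrite /in_interval P0 qP andbT /= ltNge => /negbFE/minP.
have b0 : beta (set0 : {set 'I_n}) = 0%N by rewrite /beta big_set0.
rewrite beta_pred_set leqNgt ltn_predL lt0n => /negPn/eqP bP.
by move: P0; rewrite (_ : P = set0) ?eqxx //; apply: beta_inj; rewrite bP.
Qed.

Lemma quota_set_unique (R : realDomainType) (w : 'I_n -> R) (q : R) P :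
  super_increasing w -> in_interval w q P -> quota_set w q = P.
Proof.
move=> sw; rewrite /quota_set; case: pickP => [Q /=|/(_ P) -> //].
have ltF S T : in_interval w q S -> in_interval w q T -> ~ (beta S < beta T)%N.
  move=> /and3P[_ _ leS] /and3P[_ ltT _] ltST.
  suff : weight w S <= weight w (pred_set T).
    by rewrite leNgt (lt_le_trans ltT leS).
  have : (beta S <= beta (pred_set T))%N.
    by rewrite beta_pred_set -ltnS (leq_trans ltST) ?leqSpred.
  rewrite leq_eqVlt => /predU1P[/beta_inj -> //|ltb].
  exact/ltW/weight_beta.
move=> iQ iP; apply: beta_inj; case: (ltngtP (beta Q) (beta P)) => //.
- by move/(ltF _ _ iQ iP).
- by move/(ltF _ _ iP iQ).
Qed.

End WellDefined.

(* Main.v *)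
(* A coalition S loses iff beta(S) < beta(A(q)), that is, iff there is a (unique)
   x in A(q) outside S such that S and A(q) agree before x.  Hence v(S) is 1
   minus the sum over x in A(q) of the indicators that S meets {1, ..., x} in
   A(q) :&: {1, ..., x - 1}.  Adding i to S only affects the terms with x >= i,
   and each surviving term is the event that the predecessors of i meet a set of
   x agents containing i in a prescribed set of size k, which has probability
   k! (x - 1 - k)! / x! = 1 / (x * 'C(x - 1, k)). *)

Require Import Defs.
From mathcomp Require Import all_boot all_order all_algebra all_fingroup.

Set Implicit Arguments.
Unset Strict Implicit.
Unset Printing Implicit Defensive.

Import Order.TTheory GRing.Theory Num.Theory.
Local Open Scope ring_scope.

(** * Permutations with prescribed images *)

Lemma perm_map_eq (T : finType) (s1 s2 : seq T) :
  uniq s1 -> s1 =i predT -> uniq s2 -> size s2 = size s1 ->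
  exists p : {perm T}, map p s1 = s2.
Proof.
move=> u1 full1 u2 eqsz.
(* A nonempty [s1] supplies the default element that [nth] needs. *)
case: s1 => [|x0 s] in u1 full1 eqsz *; first by exists 1%g; case: s2 eqsz u2.
set s1 := x0 :: s in u1 full1 eqsz *.
have lt_idx x : (index x s1 < size s2)%N by rewrite eqsz index_mem full1.
have injf : injective (fun x => nth x0 s2 (index x s1)).
  move=> x y /eqP; rewrite nth_uniq // => /eqP eqxy.
  by rewrite -[x](nth_index x0 (full1 x)) eqxy nth_index ?full1.
exists (perm injf); apply: (@eq_from_nth _ x0); rewrite size_map // => k ltk.
by rewrite (nth_map x0) // permE index_uniq.
Qed.

(** List [T] as [i], then [A], the rest of [U], and the complement of [U]; do the same with [j] and
    [B]. Corresponding blocks have equal length, so matching the two lists entry by entry gives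
    [p]. *)
Lemma perm_imset_draw (T : finType) (U A B : {set T}) (i j : T) :
  i \in U -> j \in U -> A \subset U :\ i -> B \subset U :\ j -> #|A| = #|B| ->
  exists p : {perm T}, [/\ p i = j, p @: A = B & p @: U = U].
Proof.
move=> iU jU sA sB cAB.
pose e x (C : {set T}) := x :: enum C ++ enum (U :\ x :\: C) ++ enum (~: U).
have eP x (C : {set T}) : x \in U -> C \subset U :\ x ->
    uniq (e x C) /\ e x C =i predT.
  move=> xU /subsetP sC; split=> [|y].
    rewrite /= !cat_uniq !enum_uniq !mem_cat !mem_enum !inE eqxx /= xU /=.
    rewrite andbF /= !andbT orbF.
    have -> : x \notin C by apply/negP => /sC; rewrite !inE eqxx.
    apply/and3P; split=> //; apply/hasPn => y.
      rewrite !(mem_cat, mem_enum) !inE; apply: contraL => yC.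
      by have:= sC _ yC; rewrite !inE yC => /andP[_ ->].
    by rewrite !mem_enum !inE => /negPf->; rewrite !andbF.
  rewrite !inE !mem_cat !mem_enum !inE.
  by case: (y == x); case: (y \in C); case: (y \in U).
have [u1 f1] := eP _ _ iU sA; have [u2 f2] := eP _ _ jU sB.
have sz : size (e j B) = size (e i A).
  by rewrite -(card_uniqP u1) -(card_uniqP u2) (eq_card f1) (eq_card f2).
have [p] := perm_map_eq u1 f1 u2 sz.
rewrite /e /= !map_cat => -[pi] /eqP.
rewrite eqseq_cat; last by rewrite size_map -!cardE.
case/andP=> /eqP pA; rewrite eqseq_cat; last first.
  have cU : #|U :\ i| = #|U :\ j|.
    by have:= cardsD1 i U; rewrite (cardsD1 j U) iU jU => -[].
  by rewrite size_map -!cardE (cardsD _ A) (cardsD _ B) (setIidPr sA)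
    (setIidPr sB) cU cAB.
have imP (C D : {set T}) : map p (enum C) = enum D -> p @: C = D.
  move=> pC; apply/setP => y; rewrite -[in RHS]mem_enum -pC.
  by apply/imsetP/mapP => -[x xC ->]; exists x; rewrite // mem_enum in xC *.
case/andP=> _ /eqP /imP pU; exists p; split=> //; first exact: imP.
(* The last block shows that [p] preserves the complement of [U], hence also [U]. *)
apply: setC_inj; rewrite -[RHS]pU.
apply/setP => y; rewrite -[y](permKV p) inE !mem_imset ?inE //; exact: perm_inj.
Qed.

(** * Counting orderings by the predecessors of an agent *)

Section PredecessorCount.

Variable n : nat.
Implicit Types (i j : 'I_n) (U A B : {set 'I_n}) (s : 'S_n).

Lemma predecessorsM i (p s : 'S_n) :
  p @: predecessors i (p * s)%g = predecessors (p i) s.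
Proof.
apply/setP => y; rewrite -[y](permKV p) mem_imset; last exact: perm_inj.
by rewrite !inE !permM.
Qed.

Definition pred_perms i U A : {set 'S_n} :=
  [set s | predecessors i s :&: U == A].

(** If [p] carries [i], [A], [U] to [j], [B], [U], then [s] to [p * s] is a bijection from the
    second set of orderings onto the first, since [p * s] applies [p] first. *)
Lemma card_pred_perms_eq i j U A B :
  i \in U -> j \in U -> A \subset U :\ i -> B \subset U :\ j -> #|A| = #|B| ->
  #|pred_perms i U A| = #|pred_perms j U B|.
Proof.
move=> iU jU sA sB cAB.
have [p [pi pA pU]] := perm_imset_draw iU jU sA sB cAB.
rewrite -(card_preimset (pred_perms i U A) (mulgI p)).
apply: eq_card => s; rewrite !inE -pi -predecessorsM -pA -{2}pU.
have injp : injective (fun C : {set 'I_n} => p @: C).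
  by apply: imset_inj; exact: perm_inj.
by rewrite -imsetI ?(inj_eq injp) // => x y _ _; apply: perm_inj.
Qed.

(** Members of [U] have distinct ranks below [#|U|] in the order [s], so by pigeonhole every rank is
    taken exactly once. *)
Lemma card_pred_rank_eq1 U s k : (k < #|U|)%N ->
  #|[set j in U | #|predecessors j s :&: U| == k]| = 1%N.
Proof.
move=> ltk; pose rk j := #|predecessors j s :&: U|.
have rk_lt j : j \in U -> (rk j < #|U|)%N.
  move=> jU; apply/proper_card/properP; split; first exact: subsetIr.
  by exists j => //; rewrite !inE ltnn.
have rk_mono x y : x \in U -> (s x < s y)%N -> (rk x < rk y)%N.
  move=> xU ltxy; apply/proper_card/properP; split.
    by apply/subsetP => z; rewrite !inE => /andP[/ltn_trans->].
  by exists x; rewrite !inE ?ltxy // ltnn.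
have rk_inj : {in U &, injective rk}.
  move=> x y xU yU eqrk; apply: (@perm_inj _ s); apply/val_inj.
  by case: (ltngtP (s x) (s y)) => // /rk_mono; rewrite eqrk ltnn;
    [move/(_ xU)|move/(_ yU)].
have sub : {subset map rk (enum U) <= iota 0 #|U|}.
  by move=> _ /mapP[x + ->]; rewrite mem_enum mem_iota => /rk_lt.
have uniq_rk : uniq (map rk (enum U)).
  rewrite map_inj_in_uniq ?enum_uniq // => x y.
  by rewrite !mem_enum; apply: rk_inj.
have [|_ eq_iota] := uniq_min_size uniq_rk sub.
  by rewrite size_iota size_map -cardE.
have : k \in map rk (enum U) by rewrite eq_iota mem_iota.
case/mapP=> j; rewrite mem_enum => jU rkj.
apply/eqP/cards1P; exists j; apply/setP => x; rewrite !inE.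
apply/andP/eqP => [[xU /eqP rkx]|->]; last by rewrite jU rkj.
by apply: rk_inj => //; rewrite -rkj.
Qed.

(* By symmetry, all pairs [(j, B)] with [j] in [U], [B] a subset of [U :\ j]
   and [#|B| = #|A|] have the same count, and each permutation realizes exactly
   one of them. *)
Lemma card_pred_perms i U A : i \in U -> A \subset U :\ i ->
  (#|pred_perms i U A| * (#|U| * 'C(#|U|.-1, #|A|)))%N = n`!.
Proof.
move=> iU sA; have cU j : j \in U -> #|U :\ j| = #|U|.-1.
  by move=> jU; rewrite (cardsD1 j U) jU.
have ltA : (#|A| < #|U|)%N.
  by rewrite (cardsD1 i U) iU add1n ltnS subset_leq_card.
transitivity (\sum_(s : 'S_n)
    #|[set j in U | #|predecessors j s :&: U| == #|A|]|)%N; last first.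
  by rewrite -[in RHS]card_Sn -[RHS]sum1_card; apply: eq_bigr => s _;
    apply: card_pred_rank_eq1.
pose ind (b : bool) : nat := if b then 1%N else 0%N.
rewrite (eq_bigr (fun s =>
    \sum_(j in U) ind (#|predecessors j s :&: U| == #|A|)))%N; last first.
  by move=> s _; rewrite -sum1dep_card big_mkcondr.
rewrite exchange_big /= mulnCA -sum_nat_const; apply: eq_bigr => j jU.
rewrite mulnC -(cU j jU) -cards_draws -sum_nat_const.
pose Bs := [set B : {set 'I_n} | B \subset U :\ j & #|B| == #|A|].
transitivity (\sum_(B in Bs) \sum_(s : 'S_n) ind (predecessors j s :&: U == B))%N.
  apply: eq_bigr => B; rewrite inE => /andP[sB /eqP cB].
  by rewrite (card_pred_perms_eq iU jU sA sB) // -sum1dep_card big_mkcond.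
rewrite exchange_big /=; apply: eq_bigr => s _.
rewrite -big_mkcondr /= sum1dep_card /ind.
case: ifP => [cA|ncA]; last first.
  apply/eqP; rewrite cards_eq0; apply/eqP/setP => B; rewrite !inE.
  by apply/negP => /andP[/andP[_ cB] /eqP eqB]; rewrite eqB cB in ncA.
apply/eqP/cards1P; exists (predecessors j s :&: U); apply/setP => B.
rewrite !inE [RHS]eq_sym; case: (_ =P B) => [<-|_]; rewrite ?andbF // cA !andbT.
apply/subsetP => x; rewrite !inE => /andP[ltx ->]; rewrite andbT.
by apply: contraTneq ltx => ->; rewrite ltnn.
Qed.

End PredecessorCount.

Lemma card_ord_lt n k : (k <= n)%N -> #|[set j : 'I_n | (j < k)%N]| = k.
Proof.
move=> lekn; rewrite -sum1dep_card -(big_ord_widen _ (fun=> 1%N) lekn).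
by rewrite sum1_card card_ord.
Qed.

Lemma prob_pred_perms (R : realFieldType) n (i : 'I_n) (U A : {set 'I_n}) :
  i \in U -> A \subset U :\ i ->
  (n`!)%:R^-1 * \sum_(s : 'S_n) (predecessors i s :&: U == A)%:R =
    1 / (#|U|%:R * 'C(#|U|.-1, #|A|)%:R) :> R.
Proof.
move=> iU sA; have cnt := card_pred_perms iU sA.
have -> : \sum_(s : 'S_n) (predecessors i s :&: U == A)%:R =
    #|pred_perms i U A|%:R :> R.
  rewrite -sum1dep_card natr_sum [RHS]big_mkcond; apply: eq_bigr => s _.
  by case: eqP.
(* As [n!] is the product in [cnt], the count of orderings is nonzero and cancels. *)
have : (n`!)%:R != 0 :> R by rewrite pnatr_eq0 -lt0n fact_gt0.
rewrite -cnt -!natrM !natrM mulf_eq0 negb_or => /andP[cne dne].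
by rewrite invfM mulrC mulrA mulfV // !mul1r.
Qed.

(** * Losing coalitions and the set A(q) *)

Section QuotaSet.

Variable n : nat.
Implicit Types (x i : 'I_n) (S A : {set 'I_n}).

Definition A_below A x : {set 'I_n} := A :&: [set j : 'I_n | (j < x)%N].

(** The left window includes [x] while [A_below A x] stops before it: for [x] in [A], one equation
    says both that [S] agrees with [A] before [x] and that [S] omits [x]. *)
Definition loses_at A S x : bool :=
  S :&: [set j : 'I_n | (j < x.+1)%N] == A_below A x.

Lemma loses_atP A S x : x \in A ->
  reflect (x \notin S /\ forall j : 'I_n, (j < x)%N -> (j \in S) = (j \in A))
          (loses_at A S x).
Proof.
move=> xA; apply: (iffP eqP) => [/setP eqSA | [xS eqSA]].
  split=> [|j ltjx].
    by have := eqSA x; rewrite !inE ltnn ltnSn andbT andbF => ->.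
  by have := eqSA j; rewrite !inE ltjx ltnS ltnW // !andbT.
apply/setP => j; rewrite !inE ltnS leq_eqVlt.
case: (ltngtP j x) => [/eqSA->|_|/val_inj->] //; rewrite ?andbF //.
by rewrite (negPf xS).
Qed.

(** [beta] reads a set as a binary numeral with the first agent as leading digit, so the first
    difference decides. *)
Lemma beta_ltP S A :
  reflect (exists2 x, x \in A & loses_at A S x) (beta S < beta A)%N.
Proof.
apply: (iffP idP) => [ltSA|[x xA /(loses_atP _ xA)[xS]]]; last exact: beta_lt_lex.
have /lex_cmp[x neq_x eqSA] : S != A by apply: contraTneq ltSA => ->; rewrite ltnn.
have [xA|xA] := boolP (x \in A); rewrite ?xA ?(negPf xA) /= in neq_x.
  exists x => //; apply/(loses_atP _ xA).
  by split => //; case: (x \in S) neq_x.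
have xS : x \in S by case: (x \in S) neq_x.
have := beta_lt_lex xS xA (fun j h => esym (eqSA j h)).
by rewrite ltnNge (ltnW ltSA).
Qed.

(** At most one term is 1: if [S] loses at [x] and at a later [y], agreement before [y] puts [x] in
    [S], a contradiction. *)
Lemma sum_loses_at (R : pzSemiRingType) A S :
  \sum_(x in A) (loses_at A S x)%:R = (beta S < beta A)%N%:R :> R.
Proof.
have [[x xA losx]|nolos] := beta_ltP S A; last first.
  apply: big1 => x xA; case: (boolP (loses_at A S x)) => // losx.
  by case: nolos; exists x.
rewrite (bigD1 x) //= losx big1 ?addr0 // => y /andP[yA neyx].
case: (loses_atP S yA) => // -[yS eqy]; have [xS eqx] := loses_atP _ xA losx.
case: (ltngtP x y) => [/eqy|/eqx|/val_inj eqxy].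
- by rewrite xA (negPf xS).
- by rewrite yA (negPf yS).
- by rewrite eqxy eqxx in neyx.
Qed.

(** No value of [beta] lies strictly between those of A(q)^- and A(q), and [weight] is monotone in
    [beta]; a smaller set thus weighs at most w(A(q)^-) < q. *)
Lemma wvg_beta (R : realDomainType) (w : 'I_n -> R) (q : R) S :
  super_increasing w -> 0 < q <= weight w [set: 'I_n] ->
  wvg w q S = 1 - (beta S < beta (quota_set w q))%N%:R.
Proof.
move=> sw /(quota_setP sw); set A := quota_set w q => /and3P[_ ltA leA].
rewrite /wvg; case: ltnP => [ltSA|leAS]; rewrite ?subrr ?subr0.
  case: leP => // leqS; have : (beta S <= beta (pred_set A))%N.
    by rewrite beta_pred_set -ltnS (leq_trans ltSA) ?leqSpred.
  rewrite leq_eqVlt => /predU1P[/beta_inj eqS|/(weight_beta sw) ltS].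
    by rewrite eqS leNgt ltA in leqS.
  by have := lt_trans ltS ltA; rewrite ltNge leqS.
suff leAw : weight w A <= weight w S by rewrite (le_trans leA leAw).
move: leAS; rewrite leq_eqVlt => /predU1P[/beta_inj-> //|/(weight_beta sw)].
exact: ltW.
Qed.

(** The condition at [x] sees agents only up to [x]: a later [i] is invisible, [i = x] rules out
    losing there, and an earlier [i] must belong to [A]. *)
Lemma loses_atU1 A S x i : x \in A -> i \notin S ->
  loses_at A (S :|: [set i]) x =
  if (i < x)%N then
    (i \in A) && (S :&: [set j : 'I_n | (j < x.+1)%N] == A_below A x :\ i)
  else (i != x) && loses_at A S x.
Proof.
move=> xA iS; rewrite /loses_at; case: ltnP => [ltix|lexi].
  apply/eqP/andP => [/setP eqSA|[iA /eqP/setP eqSA]].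
    have := eqSA i; rewrite !inE eqxx orbT ltnS ltnW // ltix !andbT => <-.
    split=> //; apply/eqP/setP => j; have := eqSA j; rewrite !inE => <-.
    by case: (j =P i) => [->|_]; rewrite ?(negPf iS) ?orbF.
  apply/setP => j; have := eqSA j; rewrite !inE => eqj.
  case: (j =P i) eqj => [-> _|_ /= <-]; rewrite ?orbF //.
  by rewrite iA ltix ltnS ltnW // orbT.
case: (i =P x) => [->|/eqP neix] /=.
  by apply/eqP => /setP/(_ x); rewrite !inE eqxx ltnn ltnSn orbT andbF.
congr (_ == _); apply/setP => j; rewrite !inE.
case: (_ =P i) => [->|_]; rewrite ?orbF // ltnS leqNgt ltn_neqAle lexi andbT.
by rewrite eq_sym (inj_eq val_inj) neix !andbF.
Qed.

Lemma shapley_quota_set (R : realFieldType) (w : 'I_n -> R) (q : R) i :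
  super_increasing w -> 0 < q <= weight w [set: 'I_n] ->
  shapley (wvg w q) i = \sum_(x in quota_set w q)
    if (i < x)%N then
      if i \in quota_set w q then
        - (1 / (x.+1%:R * 'C(x, #|A_below (quota_set w q) x| - 1)%:R))
      else 1 / (x.+1%:R * 'C(x, #|A_below (quota_set w q) x|)%:R)
    else if i == x then 1 / (x.+1%:R * 'C(x, #|A_below (quota_set w q) x|)%:R)
    else 0.
Proof.
move=> sw q_in; set A := quota_set w q.
pose U x := [set j : 'I_n | (j < x.+1)%N].
have cardU x : #|U x| = x.+1 by rewrite card_ord_lt.
have subU x : i \notin A_below A x -> A_below A x \subset U x :\ i.
  move=> iB; apply/subsetP => j jB.
  have neji : j != i by apply: contraNneq iB => <-.
  rewrite !inE neji /=.
  by move: jB; rewrite !inE => /andP[_ ltjx]; rewrite ltnS ltnW.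
have probE x (B : {set 'I_n}) : (i <= x)%N -> B \subset U x :\ i ->
    (n`!)%:R^-1 * \sum_(s : 'S_n) (predecessors i s :&: U x == B)%:R =
      1 / (x.+1%:R * 'C(x, #|B|)%:R) :> R.
  by move=> leix sB; rewrite prob_pred_perms ?cardU // inE ltnS.
(* The constants 1 cancel, leaving the losing indicators without [i] minus those with [i]. *)
rewrite /shapley; under eq_bigr => s _.
  rewrite !wvg_beta // -/A opprB addrC subrKA -!sum_loses_at -sumrB.
  over.
rewrite exchange_big mulr_sumr; apply: eq_bigr => x xA.
under eq_bigr => s _.
  rewrite loses_atU1 //; last by rewrite inE ltnn.
  over.
case: (ltngtP i x) => [ltix|ltxi|/val_inj eqix] /=.
- have [iA|iA] := boolP (i \in A) => /=.
    have iB : i \in A_below A x by rewrite !inE iA.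
    (* The truncated subtraction is exact because [i] lies in [A_below A x]. *)
    have -> : (#|A_below A x| - 1)%N = #|A_below A x :\ i|.
      by rewrite (cardsD1 i (A_below A x)) iB addKn.
    rewrite -(probE _ _ (ltnW ltix)); last first.
      apply: setSD; apply/subsetP => j; rewrite !inE => /andP[_ ltjx].
      by rewrite ltnS ltnW.
    rewrite -mulrN -sumrN; congr (_ * _); apply: eq_bigr => s _.
    (* The predecessors of [i] omit [i], so they cannot lose at a later [x] when [i] is in [A]. *)
    case: (loses_atP _ xA) => [[_ /(_ i ltix)]|_]; last by rewrite sub0r.
    by rewrite iA inE ltnn.
  rewrite -(probE _ _ (ltnW ltix)); last by apply: subU; rewrite inE (negPf iA).
  by congr (_ * _); apply: eq_bigr => s _; rewrite subr0.
- rewrite -val_eqE /= gtn_eqF // big1 ?mulr0 // => s _; by rewrite subrr.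
rewrite eqix eqxx -eqix -probE //; last by apply: subU; rewrite !inE eqix ltnn andbF.
by congr (_ * _); apply: eq_bigr => s _; rewrite subr0 eqix.
Qed.

End QuotaSet.

(** * The formula along the enumeration of A(q) *)

Theorem theorem6p1 (R : realFieldType) (n : nat) (w : 'I_n -> R)
  (w_gt0 : forall j : 'I_n, 0 < w j)
  (w_decr : forall j k : 'I_n, (j < k)%N -> w k < w j)
  (w_super : super_increasing w)
  (i : 'I_n) (q : R) (q_gt0 : 0 < q) (q_le : q <= weight w [set: 'I_n])
  (r : nat) (a : 'I_r.+1 -> 'I_n)
  (a_incr : forall s t : 'I_r.+1, (s < t)%N -> (a s < a t)%N)
  (a_enum : quota_set w q = [set a t | t : 'I_r.+1]) :
  (i \notin quota_set w q ->
     shapley (wvg w q) i =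
       \sum_(t < r.+1 | (i < a t)%N)
         1 / ((a t).+1%:R * 'C((a t).+1 - 1, t)%:R))
  /\
  (forall s : 'I_r.+1, i = a s ->
     shapley (wvg w q) i =
       1 / ((a s).+1%:R * 'C((a s).+1 - 1, s)%:R)
       - \sum_(t < r.+1 | (i < a t)%N)
           1 / ((a t).+1%:R * 'C((a t).+1 - 1, t - 1)%:R)).
Proof.
have a_inj : injective a.
  move=> s t eqa; apply/val_inj.
  by case: (ltngtP s t) => // /a_incr; rewrite eqa ltnn.
have a_mono s t : (a s < a t)%N = (s < t)%N.
  apply/idP/idP => [|/a_incr //]; apply: contraTT; rewrite -!leqNgt leq_eqVlt.
  by case/predU1P => [/val_inj->//|/a_incr/ltnW].
(* Indices start at 0, so exactly [t] elements of A(q) precede [a t]; this is the lower binomial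
   index. *)
have rank_a t : #|A_below (quota_set w q) (a t)| = t.
  transitivity #|a @: [set u : 'I_r.+1 | (u < t)%N]|.
    apply: eq_card => x; rewrite a_enum !inE; apply/andP/imsetP.
      by case=> /imsetP[u _ ->]; rewrite a_mono => ltut; exists u; rewrite ?inE.
    by case=> u; rewrite inE => ltut ->; rewrite a_mono imset_f.
  by rewrite card_imset // card_ord_lt // ltnW.
have q_in : 0 < q <= weight w [set: 'I_n] by rewrite q_gt0.
have sum_a (F : 'I_n -> R) :
    \sum_(x in quota_set w q) F x = \sum_(t < r.+1) F (a t).
  rewrite a_enum big_imset /=; last by move=> s t _ _; apply: a_inj.
  by apply: eq_bigl => t; rewrite inE.
rewrite (shapley_quota_set i w_super q_in) sum_a.
split=> [iA|s is_].
  rewrite (negPf iA) [RHS]big_mkcond /=; apply: eq_bigr => t _.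
  rewrite rank_a subn1 /=; case: ifP => // _; case: eqP => // ia.
  by rewrite a_enum ia imset_f in iA.
have iA : i \in quota_set w q by rewrite a_enum is_ imset_f.
(* The index [s] gives the leading term, and earlier indices contribute 0. Later ones satisfy
   [t > s], so [t - 1] is a true predecessor. *)
rewrite iA (bigD1 s) //= is_ ltnn eqxx rank_a subn1 /=; congr (_ + _).
rewrite -sumrN [RHS]big_mkcond [RHS](bigD1 s) //= ltnn add0r.
apply: eq_bigr => t nts; rewrite rank_a !subn1 (inj_eq a_inj) eq_sym (negPf nts).
by case: ifP.
Qed.
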